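(* Let $X$ be an ergodic (irreducible and aperiodic) discrete-time homogeneous Markov chain on a finite state space $\mathcal{X}$ with fundamental matrix $F$ and resistance distance $\Omega=(\Omega_{i,j})_{i,j\in\mathcal{X}}$. Let $M,K$ be square matrices indexed by $\mathcal{X}$ such that (1) $K\mathbf{1}=\mathbf{1}$, where $\mathbf{1}$ is the all-ones column vector of length $|\mathcal{X}|$, and (2) $M(K-I)$ is symmetric. Then $$\sum_{i,j\in\mathcal{X}}(M(K-I))_{i,j}\,\Omega_{i,j}=2\,\mathrm{Tr}\bigl(M(I-K)F\bigr),$$ where $\mathrm{Tr}$ denotes the trace.
   Context: Let $P$ be the transition matrix of $X$, $\pi$ its stationary distribution (a row vector), $\Pi$ the $|\mathcal{X}|\times|\mathcal{X}|$ matrix each of whose rows is $\pi$, and $I$ the identity matrix of the same size. The fundamental matrix of $X$ is $F=(F_{i,j})_{i,j\in\mathcal X}:=(I-P+\Pi)^{-1}$ (the inverse always exists). The resistance distance of the Markov chain is $\Omega_{i,j}:=F_{i,i}+F_{j,j}-F_{i,j}-F_{j,i}$ for $i,j\in\mathcal{X}$. *)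

(* Defs.v *)
From mathcomp Require Import all_boot all_order all_algebra.
Set Implicit Arguments.
Unset Strict Implicit.
Unset Printing Implicit Defensive.
Import Order.TTheory GRing.Theory Num.Theory.
Local Open Scope ring_scope.

(* A homogeneous Markov chain on the finite state space 'I_n is given by its
   transition matrix P, with P i j the probability of moving from i to j. *)
Definition stochastic (R : realFieldType) (n : nat) (P : 'M[R]_n) : Prop :=
  (forall i j, 0 <= P i j) /\ (forall i, \sum_j P i j = 1).

Definition irreducible_chain (R : realFieldType) (n : nat) (P : 'M[R]_n) : Prop :=
  forall i j, exists k : nat, 0 < (P ^+ k) i j.

Definition return_time (R : realFieldType) (n : nat) (P : 'M[R]_n) (i : 'I_n)
    (k : nat) : Prop :=
  (0 < k)%N /\ 0 < (P ^+ k) i i.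

(* d is the gcd of the possibly infinite set of return times to i. *)
Definition is_period (R : realFieldType) (n : nat) (P : 'M[R]_n) (i : 'I_n)
    (d : nat) : Prop :=
  (forall k, return_time P i k -> (d %| k)%N) /\
  (forall e, (forall k, return_time P i k -> (e %| k)%N) -> (e %| d)%N).

Definition aperiodic_chain (R : realFieldType) (n : nat) (P : 'M[R]_n) : Prop :=
  forall i, is_period P i 1.

Definition ergodic_chain (R : realFieldType) (n : nat) (P : 'M[R]_n) : Prop :=
  [/\ stochastic P, irreducible_chain P & aperiodic_chain P].

(* The last two conditions force 0 < n. *)
Definition stationary_distribution (R : realFieldType) (n : nat)
    (P : 'M[R]_n) (pi : 'rV[R]_n) : Prop :=
  [/\ pi *m P = pi, forall j, 0 <= pi 0 j & \sum_j pi 0 j = 1].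

Definition stationary_mx (R : realFieldType) (n : nat) (pi : 'rV[R]_n) : 'M[R]_n :=
  \matrix_(i, j) pi 0 j.

Definition fundamental_mx (R : realFieldType) (n : nat)
    (P : 'M[R]_n) (pi : 'rV[R]_n) : 'M[R]_n :=
  invmx (1%:M - P + stationary_mx pi).

Definition resistance (R : realFieldType) (n : nat)
    (P : 'M[R]_n) (pi : 'rV[R]_n) (i j : 'I_n) : R :=
  let F := fundamental_mx P pi in F i i + F j j - F i j - F j i.

Lemma stochastic_exp (R : realFieldType) (n : nat) (P : 'M[R]_n) (k : nat) :
  stochastic P -> stochastic (P ^+ k).
Proof.
move=> [P0 P1]; elim: k => [|k [IH0 IH1]].
  rewrite expr0; split=> [i j|i]; first by rewrite mxE ler0n.
  rewrite (bigD1 i) //= mxE eqxx big1 ?addr0 // => j ji.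
  by rewrite mxE eq_sym (negbTE ji).
rewrite exprS; split=> [i j|i].
  by rewrite mxE sumr_ge0 // => l _; rewrite mulr_ge0.
under eq_bigr do rewrite mxE.
rewrite exchange_big /= -[RHS](P1 i); apply: eq_bigr => l _.
by rewrite -mulr_sumr IH1 mulr1.
Qed.

(* invmx returns its argument on singular matrices; this lemma shows that
   fundamental_mx is a genuine inverse for an ergodic chain. *)
Lemma fundamental_unitmx (R : realFieldType) (n : nat)
    (P : 'M[R]_n) (pi : 'rV[R]_n) :
  ergodic_chain P -> stationary_distribution P pi ->
  1%:M - P + stationary_mx pi \in unitmx.
Proof.
move=> [stP irrP _] [piP pi0 pi1].
set A := 1%:M - P + _.
have piPi : pi *m stationary_mx pi = pi.
  apply/rowP => j; rewrite mxE.
  under eq_bigr do rewrite mxE.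
  by rewrite -mulr_suml pi1 mul1r.
rewrite -unitmx_tr -row_free_unit; apply: inj_row_free => w wA.
pose v := w^T.
have Av : A *m v = 0 by rewrite -[A]trmxK -trmx_mul wA trmx0.
have piv : pi *m v = 0.
  have: pi *m (A *m v) = 0 by rewrite Av mulmx0.
  by rewrite mulmxA mulmxDr mulmxBr mulmx1 piP subrr add0r piPi.
have Piv : stationary_mx pi *m v = 0.
  apply/colP => i; rewrite !mxE.
  move/matrixP/(_ 0 0): piv; rewrite !mxE => piv.
  by rewrite -[RHS]piv; apply: eq_bigr => j _; rewrite mxE.
have Pv : P *m v = v.
  by move: Av; rewrite mulmxDl Piv addr0 mulmxBl mul1mx => /subr0_eq.
have Pkv k : (P ^+ k) *m v = v.
  elim: k => [|k IH]; first by rewrite expr0 mul1mx.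
  by rewrite exprS -mulmxA IH Pv.
have [i0 _|noi] := pickP 'I_n; last by apply/rowP => j; move: (noi j).
case: (arg_maxP (fun i => v i 0) (erefl : predT i0)) => i _ vi.
have vc j : v j 0 = v i 0.
  have [k Pij] := irrP i j.
  have [Pk0 Pk1] := stochastic_exp k stP.
  have S0 : \sum_l (P ^+ k) i l * (v i 0 - v l 0) = 0.
    under eq_bigr do rewrite mulrBr.
    rewrite sumrB -mulr_suml Pk1 mul1r.
    by move/matrixP/(_ i 0): (Pkv k); rewrite mxE => ->; rewrite subrr.
  have /(_ j isT)/eqP : forall l, true -> (P ^+ k) i l * (v i 0 - v l 0) = 0.
    by apply: psumr_eq0P => // l _; rewrite mulr_ge0 // subr_ge0; exact: vi.
  by rewrite mulf_eq0 gt_eqF //= subr_eq0 => /eqP.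
have vi0 : v i 0 = 0.
  move/matrixP/(_ 0 0): piv; rewrite mxE [RHS]mxE => <-.
  under [RHS]eq_bigr do rewrite vc.
  by rewrite -mulr_suml pi1 mul1r.
by apply/rowP => j; have := vc j; rewrite vi0 !mxE.
Qed.

(* Main.v *)
Require Import Defs.
From mathcomp Require Import all_boot all_order all_algebra.
Import GRing.Theory.
Local Open Scope ring_scope.

(** The matrix [S := M (K - 1)] is symmetric, and its rows sum to zero because
    [K] fixes the all-ones vector; by symmetry its columns sum to zero too.
    When [S i j * (F i i + F j j - F i j - F j i)] is summed, the terms in
    [F i i] vanish because of the rows and those in [F j j] because of the
    columns, while the terms in [F j i] give [\tr (S *m F)], and so do those
    in [F i j] by the symmetry of [S].  What remains is [- 2 \tr (S *m F)], and
    the sign turns [K - 1] into [1 - K].  The cancellation is purely algebraic: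
    it is [sum_laplacian_resistance], stated for any matrix [F]. *)


Lemma sum_row_mx_const1 (R : pzSemiRingType) (m n : nat) (A : 'M[R]_(m, n))
    (i : 'I_m) :
  (A *m const_mx 1 : 'cV_m) i 0 = \sum_j A i j.
Proof. by rewrite mxE; apply: eq_bigr => j _; rewrite mxE mulr1. Qed.

(** A symmetric matrix with zero row sums acts like a graph Laplacian:
    functions of [i] alone or of [j] alone are invisible to it. *)
Lemma sum_laplacian_resistance (R : pzRingType) (n : nat) (S F : 'M[R]_n) :
  S^T = S -> S *m const_mx 1 = 0 :> 'cV_n ->
  \sum_i \sum_j S i j * (F i i + F j j - F i j - F j i)
  = - (2 * \tr (S *m F)).
Proof.
move=> symS S1.
have Sji i j : S j i = S i j by rewrite -[in LHS]symS mxE.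
have row0 i : \sum_j S i j = 0 by rewrite -sum_row_mx_const1 S1 mxE.
have sumFii : \sum_i \sum_j S i j * F i i = 0.
  by apply: big1 => i _; rewrite -mulr_suml row0 mul0r.
have sumFjj : \sum_i \sum_j S i j * F j j = 0.
  rewrite exchange_big -[RHS]sumFii; apply: eq_bigr => j _.
  by apply: eq_bigr => i _; rewrite Sji.
have sumFji : \sum_i \sum_j S i j * F j i = \tr (S *m F).
  by apply: eq_bigr => i _; rewrite mxE.
have sumFij : \sum_i \sum_j S i j * F i j = \tr (S *m F).
  rewrite exchange_big -sumFji; apply: eq_bigr => j _.
  by apply: eq_bigr => i _; rewrite Sji.
under eq_bigr => i _.
  under eq_bigr do rewrite !mulrBr mulrDr.
  rewrite !sumrB big_split /=.
  over.
rewrite !sumrB big_split /= sumFii sumFjj sumFij sumFji.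
by rewrite addr0 sub0r -opprD mulr_natl mulr2n.
Qed.

Theorem lemma1p1 (R : realFieldType) (n : nat) (P : 'M[R]_n) (pi : 'rV[R]_n)
    (hP : ergodic_chain P) (hpi : stationary_distribution P pi)
    (M K : 'M[R]_n)
    (hK : K *m const_mx 1 = const_mx 1 :> 'cV[R]_n)
    (hMK : (M *m (K - 1%:M))^T = M *m (K - 1%:M)) :
  \sum_(i < n) \sum_(j < n) (M *m (K - 1%:M)) i j * resistance P pi i j
  = 2 * \tr (M *m (1%:M - K) *m fundamental_mx P pi).
Proof.
rewrite sum_laplacian_resistance //.
  by rewrite -mulrN -raddfN /= -mulNmx -mulmxN opprB.
by rewrite -mulmxA mulmxBl hK mul1mx subrr mulmx0.
Qed.
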